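(* For every cooperative interval game $(N,w)$ we have $\mathrm{gen}(\mathcal{C}(w)) \subseteq \mathcal{SC}(w)$.
   Context: Let $N=\{1,2,\ldots,n\}$ be a set of players, $2^N$ its power set, and $\mathbb{IR}$ the set of all closed real intervals $X=[\underline{X},\overline{X}]$. Interval addition is $X+Y=[\underline{X}+\underline{Y},\overline{X}+\overline{Y}]$, and $I\succeq J$ means $\underline{I}\ge\underline{J}$ and $\overline{I}\ge\overline{J}$. A (classical) cooperative game is a pair $(N,v)$ with $v:2^N\to\mathbb{R}$ and $v(\emptyset)=0$. A cooperative interval game is a pair $(N,w)$ with $w:2^N\to\mathbb{IR}$ and $w(\emptyset)=[0,0]$; write $w(i)$ for $w(\{i\})$. A selection of $(N,w)$ is a cooperative game $(N,v)$ with $v(S)\in w(S)$ for every $S\in 2^N$; $\mathrm{Sel}(w)$ is the set of all selections. For a cooperative game $v$, the imputation set is $I(v)=\{x\in\mathbb{R}^N: \sum_{i\in N}x_i=v(N),\ x_i\ge v(\{i\})\ \forall i\in N\}$ and the core is $C(v)=\{x\in I(v): \sum_{i\in S}x_i\ge v(S)\ \forall S\subseteq N\}$. The selection core is $\mathcal{SC}(w)=\bigcup\{C(v): v\in\mathrm{Sel}(w)\}\subseteq\mathbb{R}^N$. The set of interval imputations is $\mathcal{I}(w)=\{(I_1,\ldots,I_n)\in\mathbb{IR}^N: \sum_{i\in N}I_i=w(N),\ I_i\succeq w(i)\ \forall i\in N\}$ and the interval core is $\mathcal{C}(w)=\{(I_1,\ldots,I_n)\in\mathcal{I}(w): \sum_{i\in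 S}I_i\succeq w(S)\ \forall S\in 2^N\setminus\{\emptyset\}\}$. For a set $A\subseteq\mathbb{IR}^N$ of interval vectors, $\mathrm{gen}(A)=\bigcup_{s\in A}\{(x_1,\ldots,x_n)\in\mathbb{R}^N: x_i\in s_i\ \forall i\in N\}$. *)

(* Defs.v *)
From HB Require Import structures.
From mathcomp Require Import all_boot all_order all_algebra.
From mathcomp Require Import boolp classical_sets reals.

Set Implicit Arguments.
Unset Strict Implicit.
Unset Printing Implicit Defensive.

Import Order.TTheory GRing.Theory Num.Theory.
Local Open Scope classical_set_scope.
Local Open Scope ring_scope.

(* Nonempty closed bounded intervals [lo, hi], coded by their endpoints. *)
Record citv (R : realType) := Citv {
  citv_val : R * R;
  _ : citv_val.1 <= citv_val.2 }.

HB.instance Definition _ (R : realType) := [isSub for @citv_val R].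
HB.instance Definition _ (R : realType) := [Choice of citv R by <:].

Definition lo (R : realType) (X : citv R) : R := (citv_val X).1.
Definition hi (R : realType) (X : citv R) : R := (citv_val X).2.

Definition citv_pt (R : realType) (X : citv R) (x : R) : Prop :=
  x \in `[lo X, hi X].

Definition citv0 (R : realType) : citv R := @Citv R (0, 0) (lexx 0).

Definition citv_add (R : realType) (X Y : citv R) : citv R :=
  @Citv R (lo X + lo Y, hi X + hi Y) (lerD (valP X) (valP Y)).

Lemma citv_addA (R : realType) : associative (@citv_add R).
Proof. by move=> X Y Z; apply/val_inj; rewrite /= /lo /hi /= !addrA. Qed.

Lemma citv_addC (R : realType) : commutative (@citv_add R).
Proof.
by move=> X Y; apply/val_inj; congr pair; apply: addrC.
Qed.

Lemma citv_add0 (R : realType) : left_id (citv0 R) (@citv_add R).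
Proof. by move=> [[a b] le_ab]; apply/val_inj; rewrite /= /lo /hi /= !add0r. Qed.

HB.instance Definition _ (R : realType) :=
  GRing.isNmodule.Build (citv R)
    (@citv_addA R) (@citv_addC R) (@citv_add0 R).

Definition citv_ge (R : realType) (I J : citv R) : Prop :=
  lo J <= lo I /\ hi J <= hi I.

(* The player set {1, ..., n} is 'I_n. *)

Record coop_game (R : realType) (n : nat) := CoopGame {
  game_val :> {set 'I_n} -> R;
  game_val0 : game_val finset.set0 = 0 }.

Record interval_game (R : realType) (n : nat) := IntervalGame {
  igame_val :> {set 'I_n} -> citv R;
  igame_val0 : igame_val finset.set0 = citv0 R }.

Definition selections (R : realType) (n : nat) (w : interval_game R n)
  : set (coop_game R n) :=
  [set v | forall S : {set 'I_n}, citv_pt (w S) (v S)].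

Definition imputations (R : realType) (n : nat) (v : coop_game R n)
  : set ('I_n -> R) :=
  [set x | \sum_(i < n) x i = v [set: 'I_n]%SET /\
           forall i : 'I_n, v [set i]%SET <= x i].

Definition core (R : realType) (n : nat) (v : coop_game R n)
  : set ('I_n -> R) :=
  [set x | imputations v x /\
           forall S : {set 'I_n}, v S <= \sum_(i in S) x i].

Definition selection_core (R : realType) (n : nat) (w : interval_game R n)
  : set ('I_n -> R) :=
  \bigcup_(v in selections w) core v.

Definition interval_imputations (R : realType) (n : nat)
    (w : interval_game R n) : set ('I_n -> citv R) :=
  [set I | \sum_(i < n) I i = w [set: 'I_n]%SET /\
           forall i : 'I_n, citv_ge (I i) (w [set i]%SET)].

Definition interval_core (R : realType) (n : nat) (w : interval_game R n)
  : set ('I_n -> citv R) :=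
  [set I | interval_imputations w I /\
           forall S : {set 'I_n}, S != finset.set0 ->
             citv_ge (\sum_(i in S) I i) (w S)].

Definition gen (R : realType) (n : nat) (A : set ('I_n -> citv R))
  : set ('I_n -> R) :=
  \bigcup_(s in A) [set x | forall i : 'I_n, citv_pt (s i) (x i)].

(* Main.v *)
(** If [x] is generated by an interval core element [I], the game
    [v S = min (\sum_(i in S) x i) (hi (w S))] is a selection of [w], since
    [lo (w S) <= lo (\sum_(i in S) I i) <= \sum_(i in S) x i], and [x] lies in
    its core: no coalition can object to the cap by coalition sums, and on the
    grand coalition the cap by [hi (w N) = hi (\sum_i I i)] is inactive. *)

Require Import Defs.
From mathcomp Require Import all_boot all_order all_algebra.
From mathcomp Require Import boolp classical_sets reals.

Local Open Scope classical_set_scope.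

Import Order.TTheory GRing.Theory Num.Theory.
Local Open Scope ring_scope.

Lemma lo_sum (R : realType) (I : Type) (r : seq I) (P : pred I)
    (F : I -> citv R) :
  lo (\sum_(i <- r | P i) F i) = \sum_(i <- r | P i) lo (F i).
Proof. exact: (big_morph (@lo R)). Qed.

Lemma hi_sum (R : realType) (I : Type) (r : seq I) (P : pred I)
    (F : I -> citv R) :
  hi (\sum_(i <- r | P i) F i) = \sum_(i <- r | P i) hi (F i).
Proof. exact: (big_morph (@hi R)). Qed.

(** Endpoints add, so the bounds can be summed termwise. Coalitions will use the lower bound, the
    grand coalition the upper one. *)
Lemma citv_pt_sum (R : realType) (I : Type) (r : seq I) (P : pred I)
    (F : I -> citv R) (x : I -> R) :
  (forall i, citv_pt (F i) (x i)) ->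
  citv_pt (\sum_(i <- r | P i) F i) (\sum_(i <- r | P i) x i).
Proof.
move=> Fx; rewrite /citv_pt in_itv /= lo_sum hi_sum.
by apply/andP; split; apply: ler_sum => i _;
  have := Fx i; rewrite /citv_pt in_itv /= => /andP[].
Qed.

Section CappedGame.
Context {R : realType} {n : nat} (w : interval_game R n) (x : 'I_n -> R).

Definition capped_sum (S : {set 'I_n}) : R :=
  Num.min (\sum_(i in S) x i) (hi (w S)).

Lemma capped_sum0 : capped_sum finset.set0 = 0.
Proof. by rewrite /capped_sum big_set0 igame_val0 minxx. Qed.

Definition capped_game : coop_game R n := CoopGame capped_sum0.

Lemma capped_game_le (S : {set 'I_n}) : capped_game S <= \sum_(i in S) x i.
Proof. by rewrite /= /capped_sum ge_min lexx. Qed.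

(** The cap gives the upper bound. For the lower one, both arguments of the minimum dominate
    [lo (w S)], the second because the endpoints of [w S] are ordered. *)
Lemma capped_game_selection :
  (forall S : {set 'I_n}, lo (w S) <= \sum_(i in S) x i) ->
  selections w capped_game.
Proof.
move=> lo_le S; rewrite /citv_pt in_itv /= /capped_sum le_min lo_le.
by rewrite (valP (w S)) ge_min lexx orbT.
Qed.

Lemma capped_game_core :
  \sum_(i < n) x i <= hi (w [set: 'I_n]%SET) -> core capped_game x.
Proof.
move=> le_hi; split; last exact: capped_game_le.
(* Individual rationality is the singleton case of [capped_game_le]; efficiency remains. *)
split=> [|i]; last by have := capped_game_le [set i]%SET; rewrite big_set1.
have sumT : \sum_(i in [set: 'I_n]%SET) x i = \sum_(i < n) x i.
  by apply: eq_bigl => i; rewrite finset.in_setT.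
by rewrite /= /capped_sum sumT min_l.
Qed.

End CappedGame.

Theorem theorem7 (R : realType) (n : nat) (w : interval_game R n) :
  gen (interval_core w) `<=` selection_core w.
Proof.
move=> x [I [[sumI _] I_ge] Ix].
exists (capped_game w x).
  apply: capped_game_selection => S.
  (* [I_ge] covers nonempty coalitions only; at the empty one both sides are 0. *)
  have [->|/I_ge[lo_le _]] := eqVneq S finset.set0.
    by rewrite big_set0 igame_val0.
  apply: le_trans lo_le _.
  by have := citv_pt_sum _ _ (index_enum 'I_n) (mem S) _ _ Ix;
    rewrite /citv_pt in_itv /= => /andP[].
(* Efficiency of [I] turns the cap at the grand coalition into the upper endpoint of the sum of the
   [I i]. *)
apply: capped_game_core; rewrite -sumI.
by have := citv_pt_sum _ _ (index_enum 'I_n) xpredT _ _ Ix;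
  rewrite /citv_pt in_itv /= => /andP[].
Qed.
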